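(* Let $n\geq 2$ and $1\leq k\leq n$ be integers, and let $S_n$ be the $n$-dimensional shift on $\mathbb{C}^n$. If $1\leq k\leq\left[\frac{n+1}{2}\right]$, then $$\Lambda_k(S_n)=\left\{z\in\mathbb{C} : |z|\leq\cos\frac{k\pi}{n+1}\right\},$$ and if $\left[\frac{n+1}{2}\right]<k\leq n$, then $\Lambda_k(S_n)=\emptyset$.
   Context: $S_n$ denotes the $n\times n$ complex matrix with entries $1$ on the first subdiagonal (positions $(i+1,i)$, $1\leq i\leq n-1$) and $0$ elsewhere, acting on $\mathbb{C}^n$ with its standard inner product. For a bounded linear operator $T$ on a complex Hilbert space and an integer $k\geq 1$, the higher rank-$k$ numerical range of $T$ is $$\Lambda_k(T)=\{\lambda\in\mathbb{C} : PTP=\lambda P \text{ for some rank-}k\text{ orthogonal projection } P\}.$$ $[x]$ denotes the integer part of the real number $x$. *)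

(* Defs.v *)
From mathcomp Require Import all_boot all_order all_algebra.
From mathcomp Require Import sesquilinear spectral.
From mathcomp Require Import classical_sets.

Set Implicit Arguments.
Unset Strict Implicit.
Unset Printing Implicit Defensive.

Import GRing.Theory.
Local Open Scope ring_scope.
Local Open Scope sesquilinear_scope.
Local Open Scope classical_set_scope.

(* Matrices act on column vectors: [T] is the operator [x |-> T *m x] on
   column space, so that composition is [*m]. *)
Section HigherRank.
Variables (C : numClosedFieldType) (n : nat).

Definition orthogonal_projection (P : 'M[C]_n) : Prop :=
  P *m P = P /\ P ^t* = P.

Definition higher_rank_numerical_range (k : nat) (T : 'M[C]_n) : set C :=
  [set lambda | exists P : 'M[C]_n,
     [/\ orthogonal_projection P, \rank P = k & P *m T *m P = lambda *: P]].

Definition shift_mx : 'M[C]_n := \matrix_(i, j) (i == j.+1 :> nat)%:R.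

End HigherRank.

Arguments shift_mx C n : clear implicits.

(* Main.v *)
(** The numerical range is invariant under rotation (conjugate by
    diag(w^i), |w| = 1), so only real points r matter.

    Upper bound: the vectors (sin(m a_j))_m, a_j = j pi/(n+1), are orthogonal
    eigenvectors of S + S^T for 2 cos a_j.  The range of a rank-k projection
    meets the span of those with j >= k, whence r <= cos a_k.  This is negative
    for k > (n+1)/2, so the range is then empty.

    Lower bound: l belongs to the range iff the sesquilinear form of S - l has
    a k-dimensional totally isotropic subspace.  For 0 < r <= cos a_k and j <= k
    choose s_j in (0, 1] with 2 s_j cos a_j = r (1 + s_j^2).  Then
    y_j = (s_j^m sin(m a_j))_m solves y_j (S - r) = - s_j^2 y_j (S - r)^T, so
    g_ij = y_i (S - r) y_j^T satisfies g_ij = - s_i^2 g_ji.  Hence g_ii = 0, and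
    g_ij = (s_i s_j)^2 g_ij = 0 for i <> j because the s_j are distinct.  The
    y_j are independent as eigenvectors of a pencil for distinct eigenvalues.
    For r = 0 take the coordinate vectors e_1, e_3, e_5, ... *)

Require Import Defs.
From mathcomp Require Import all_boot all_order all_algebra.
From mathcomp Require Import sesquilinear spectral.
From mathcomp Require Import complex.
From mathcomp Require Import classical_sets reals trigo.
From mathcomp Require Import ring lra zify.

Import Order.TTheory GRing.Theory Num.Theory.
Local Open Scope ring_scope.
Local Open Scope complex_scope.
Local Open Scope classical_set_scope.

(** * Isotropic subspaces, rotation invariance and independence of rows *)

Section NumericalRange.
Local Open Scope sesquilinear_scope.
Variable C : numClosedFieldType.

(** Gram-Schmidt gives orthonormal rows [Q] in the row space of [Y]; isotropy passes to [Q], so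
    [Q T Q^t* = l] and [Q^t* Q] is the required projection. *)
Lemma isotropic_higher_rank n k (T : 'M[C]_n) (l : C) (Y : 'M[C]_(k, n)) :
  row_free Y -> Y *m (T - l%:M) *m Y^t* = 0 ->
  higher_rank_numerical_range k T l.
Proof.
move=> Yfree Yiso.
have kn : (k <= n)%N by rewrite -(eqP Yfree) rank_leq_col.
have /unitarymxP Q1 := schmidt_unitarymx Y kn; set Q := schmidt Y in Q1.
have /submxP[G QG] : (Q <= Y)%MS by rewrite (eqmx_schmidt_free Yfree).
have QT : Q *m T *m Q^t* = l%:M.
  suff /eqP : Q *m (T - l%:M) *m Q^t* = 0.
    by rewrite mulmxBr mulmxBl mul_mx_scalar -scalemxAl Q1 scalemx1 subr_eq0
      => /eqP.
  rewrite QG trmx_mul map_mxM !mulmxA.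
  by rewrite -[G *m Y *m _]mulmxA -[G *m _ *m Y^t*]mulmxA Yiso mulmx0 mul0mx.
exists (Q^t* *m Q); split.
- split; first by rewrite mulmxA -(mulmxA (Q^t*)) Q1 mulmx1.
  by rewrite trmx_mul map_mxM trmxCK.
- apply/eqP; rewrite eqn_leq; apply/andP; split.
    by rewrite (leq_trans (mxrankM_maxr _ _)) ?rank_leq_row.
  (* [Q = Q (Q^t* Q)], so the product keeps the full rank [k]. *)
  rewrite -{1}(mxrank_unitary (schmidt_unitarymx Y kn)) -/Q.
  by rewrite -{1}[Q]mul1mx -Q1 -mulmxA mxrankM_maxr.
- rewrite !mulmxA -(mulmxA _ Q T) -(mulmxA _ (Q *m T)) QT.
  by rewrite -(mulmxA _ _ Q) mul_scalar_mx -scalemxAr.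
Qed.

(** Conjugation by [D] multiplies the entry at (i+1, i) by [w^(i+1) conj(w)^i = w], and a unitary
    change of basis preserves projections and ranks. *)
Lemma higher_rank_shift_rotate n k (l w : C) : `|w| = 1 ->
  higher_rank_numerical_range k (shift_mx C n) l ->
  higher_rank_numerical_range k (shift_mx C n) (w * l).
Proof.
move=> w1 [P [[PP Padj] rP PSP]].
have ww : w * w^* = 1 by rewrite -normCK w1 expr1n.
pose D : 'M[C]_n := diag_mx (\row_i w ^+ i).
have Dadj : D^t* = diag_mx (\row_i w^* ^+ i).
  apply/matrixP=> i j; rewrite !mxE eq_sym; case: eqVneq => [->|_] //=.
    by rewrite !mulr1n rmorphXn.
  by rewrite !mulr0n rmorph0.
have DU : D \is unitarymx.
  apply/unitarymxP; rewrite Dadj mulmx_diag -diag_const_mx; congr diag_mx.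
  by apply/rowP=> i; rewrite !mxE -exprMn ww expr1n.
have DD := unitarymxP DU.
have D'D := mulmx1C DD.
have DSD : D *m shift_mx C n *m D^t* = w *: shift_mx C n.
  rewrite Dadj; apply/matrixP=> i j; rewrite mul_mx_diag mul_diag_mx !mxE.
  case: eqP => [->|_]; last by rewrite !mulr0 mul0r.
  by rewrite exprS !mulr1 -mulrA -exprMn ww expr1n mulr1.
exists (D^t* *m P *m D); split.
- split; last by rewrite !trmx_mul !map_mxM trmxCK Padj mulmxA.
  by rewrite !mulmxA -[_ *m D *m D^t*]mulmxA DD mulmx1 -[_ *m P *m P]mulmxA PP.
- rewrite mxrankMfree ?row_free_unit ?unitarymx_unit //.
  rewrite -mxrank_tr trmx_mul mxrankMfree ?mxrank_tr ?row_free_unit //.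
  by rewrite unitmx_tr unitarymx_unit ?trmxC_unitary.
- have -> : D^t* *m P *m D *m shift_mx C n *m (D^t* *m P *m D)
     = D^t* *m (P *m (D *m shift_mx C n *m D^t*) *m P) *m D.
    by rewrite !mulmxA.
  by rewrite DSD -scalemxAr -scalemxAl PSP scalerA -scalemxAr -scalemxAl.
Qed.

Lemma diag_form m (c : 'rV[C]_m) (e : 'rV[C]_m) :
  (c *m diag_mx e *m c^t*) 0 0 = \sum_i e 0 i * `|c 0 i| ^+ 2.
Proof.
rewrite mxE; apply: eq_bigr => i _.
by rewrite mul_mx_diag !mxE normCK mulrAC mulrC.
Qed.

Lemma row_sqnorm_gt0 m (x : 'rV[C]_m) : x != 0 -> 0 < (x *m x^t*) 0 0.
Proof.
move=> x0; rewrite -[x in x *m _]mulmx1 -diag_const_mx diag_form.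
under eq_bigr do rewrite mxE mul1r.
have e0 j : true -> 0 <= `|x 0 j| ^+ 2 by rewrite exprn_ge0.
rewrite lt_def sumr_ge0 ?andbT //.
apply: contra x0 => /eqP s0; apply/eqP/rowP=> i.
have /eqP : `|x 0 i| ^+ 2 = 0 by apply: (psumr_eq0P e0 s0).
by rewrite !mxE expf_eq0 normr_eq0 => /eqP.
Qed.

End NumericalRange.

(* Applying [diag d] repeatedly to a relation [v Y = 0] yields a Vandermonde
   system for the [v_j Y_(j, j0)]. *)
Lemma pencil_row_free (F : fieldType) k n (A B : 'M[F]_n) (d : 'rV[F]_k)
    (Y : 'M[F]_(k, n)) (j0 : 'I_n) :
  Y *m A = diag_mx d *m Y *m B -> B \in unitmx -> injective (d 0) ->
  (forall i, Y i j0 != 0) -> row_free Y.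
Proof.
move=> YA Bu dinj Yj0; apply/inj_row_free => v vY.
have vdY e : (\row_j (v 0 j * d 0 j ^+ e)) *m Y = 0.
  elim: e => [|e IH].
    by rewrite -[RHS]vY; congr (_ *m _); apply/rowP=> j; rewrite !mxE mulr1.
  apply: (can_inj (mulmxK Bu)); rewrite mul0mx.
  suff -> : \row_j (v 0 j * d 0 j ^+ e.+1)
      = (\row_j (v 0 j * d 0 j ^+ e)) *m diag_mx d.
    by rewrite -!mulmxA [diag_mx d *m _]mulmxA -YA mulmxA IH mul0mx.
  by apply/rowP=> j; rewrite mul_mx_diag !mxE exprSr mulrA.
have Vu : Vandermonde k d \in unitmx.
  rewrite unitmxE det_Vandermonde unitfE; apply/prodf_neq0 => i _.
  apply/prodf_neq0 => j ij; rewrite subr_eq0; apply: contraTneq ij => /dinj ->.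
  by rewrite ltnn.
have : Vandermonde k d *m (\col_j (v 0 j * Y j j0)) = 0.
  apply/colP=> e; have /rowP/(_ j0) := vdY e; rewrite !mxE => vYe; rewrite -[RHS]vYe.
  by apply: eq_bigr => j _; rewrite !mxE mulrCA mulrA.
move/(congr1 (mulmx (invmx (Vandermonde k d)))); rewrite mulKmx // mulmx0.
move=> /colP v0; apply/rowP=> j; have /eqP := v0 j.
by rewrite !mxE mulf_eq0 (negPf (Yj0 j)) orbF => /eqP.
Qed.

(** * Shift matrices and sine vectors *)

(** Same entries as [shift_mx], over any nonzero ring: the sine vectors are real, so their algebra
    is done over the reals and then embedded. *)
Definition subdiag_mx (F : nzRingType) n : 'M[F]_n :=
  \matrix_(i, j) (i == j.+1 :> nat)%:R.

(** Column [m] samples [f] at [m+1], so the window is 1..n; the boundary value at [n+1] matches the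
    zero that the shift leaves in the last column. *)
Lemma mul_subdiag_mx (F : nzRingType) k n (f : 'I_k -> nat -> F) :
  (forall i, f i n.+1 = 0) ->
  (\matrix_(i < k, m < n) f i m.+1) *m subdiag_mx F n = \matrix_(i, m) f i m.+2.
Proof.
move=> fn; apply/matrixP=> i m; rewrite !mxE.
have [mn|mn] := ltnP m.+1 n.
  rewrite (bigD1 (Ordinal mn)) //= big1 ?addr0 ?mxE ?eqxx ?mulr1 // => j jm.
  by rewrite !mxE -(inj_eq val_inj) /= in jm *; rewrite (negPf jm) mulr0.
rewrite big1 => [|j _]; first by rewrite (_ : m.+2 = n.+1) ?fn //; have := ltn_ord m; lia.
by rewrite !mxE (_ : _ == _ = false) ?mulr0 //; have := ltn_ord j; lia.
Qed.

(** The opposite translation: here the value of [f] at 0 matches the zero first column. *)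
Lemma mul_subdiag_mx_tr (F : nzRingType) k n (f : 'I_k -> nat -> F) :
  (forall i, f i 0%N = 0) ->
  (\matrix_(i < k, m < n) f i m.+1) *m (subdiag_mx F n)^T = \matrix_(i, m) f i m.
Proof.
move=> f0; apply/matrixP=> i [[|m] mn]; rewrite !mxE /=.
  by rewrite big1 ?f0 // => j _; rewrite !mxE /= mulr0.
rewrite (bigD1 (Ordinal (ltnW mn))) //= big1 ?addr0 ?mxE ?eqxx ?mulr1 // => j jm.
by rewrite !mxE /= eqSS -(inj_eq val_inj) /= in jm *; rewrite eq_sym (negPf jm) mulr0.
Qed.

Lemma sin_rec (R : realType) (a : R) m :
  sin (m.+2%:R * a) + sin (m%:R * a) = 2 * cos a * sin (m.+1%:R * a).
Proof.
have -> : m.+2%:R * a = m.+1%:R * a + a by rewrite -[m.+2]addn1 natrD mulrDl mul1r.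
have -> : m%:R * a = m.+1%:R * a - a by rewrite -[m.+1]addn1 natrD mulrDl mul1r addrK.
rewrite sinD sinB; ring.
Qed.

Lemma sin_natpi (R : realType) m : sin (m%:R * pi) = 0 :> R.
Proof.
elim: m => [|m IH]; first by rewrite mul0r sin0.
by rewrite -addn1 natrD mulrDl mul1r sinDpi IH oppr0.
Qed.

Definition node (R : realType) n j : R := j%:R * pi / (n + 1)%:R.

Lemma node_itv (R : realType) n j : (j <= n)%N -> node R n j \in `[0, pi]%R.
Proof.
move=> jn; have n0 : 0 < (n + 1)%:R :> R by rewrite ltr0n addn1.
rewrite in_itv /= /node divr_ge0 ?mulr_ge0 ?pi_ge0 ?ler0n //=.
rewrite ler_pdivrMr // mulrC ler_wpM2l ?pi_ge0 // ler_nat; lia.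
Qed.

Lemma sin_node_gt0 (R : realType) n j : (0 < j <= n)%N -> 0 < sin (node R n j).
Proof.
case/andP=> j0 jn; have n0 : 0 < (n + 1)%:R :> R by rewrite ltr0n addn1.
apply: sin_gt0_pi; rewrite /node divr_gt0 ?mulr_gt0 ?pi_gt0 ?ltr0n //=.
rewrite ltr_pdivrMr // mulrC ltr_pM2l ?pi_gt0 // ltr_nat; lia.
by rewrite addn1.
Qed.

Lemma cos_node_lt (R : realType) n i j :
  (i < j)%N -> (j <= n)%N -> cos (node R n j) < cos (node R n i).
Proof.
move=> ij jn; rewrite ltr_cos ?node_itv //; last by lia.
by rewrite /node ltr_pM2r ?invr_gt0 ?ltr0n ?addn1 // ltr_pM2r ?pi_gt0 // ltr_nat.
Qed.

Lemma sin_mul_node (R : realType) n j : sin (n.+1%:R * node R n j) = 0.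
Proof.
by rewrite /node addn1 [_ * (_ / _)]mulrC divfK ?pnatr_eq0 // sin_natpi.
Qed.

(** Weights 1 give the eigenvectors of [S + S^T]; the weights from [reciprocal_root] give the
    isotropic vectors. *)
Definition sin_mx (R : realType) k n (s a : 'I_k -> R) : 'M[R]_(k, n) :=
  \matrix_(i, m) (s i ^+ m.+1 * sin (m.+1%:R * a i)).

(** This is the sine recurrence scaled by [s^(m+2)]; the sine vanishes at indices 0 and n+1, so it
    holds in the end columns too. *)
Lemma sin_mx_shift (R : realType) k n (s a : 'I_k -> R) :
    (forall i, sin (n.+1%:R * a i) = 0) ->
  sin_mx R k n s a *m subdiag_mx R n
    + diag_mx (\row_i s i ^+ 2) *m sin_mx R k n s a *m (subdiag_mx R n)^T
  = diag_mx (\row_i (2 * s i * cos (a i))) *m sin_mx R k n s a.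
Proof.
move=> sna; rewrite -mulmxA.
rewrite (@mul_subdiag_mx _ _ _ (fun i m => s i ^+ m * sin (m%:R * a i))); last first.
  by move=> i; rewrite sna mulr0.
rewrite (@mul_subdiag_mx_tr _ _ _ (fun i m => s i ^+ m * sin (m%:R * a i))); last first.
  by move=> i; rewrite mul0r sin0 mulr0.
apply/matrixP=> i m; rewrite !mul_diag_mx !mxE.
rewrite mulrA -exprD -mulrDr sin_rec exprS; ring.
Qed.

(** Supplies the column without zeros that [pencil_row_free] asks for. *)
Lemma sin_mx_free_col (R : realType) k n (s : 'I_k -> R) (h : 'I_k -> nat)
    (n0 : (0 < n)%N) :
  (forall i, 0 < s i) -> (forall i, (0 < h i <= n)%N) ->
  forall i, sin_mx R k n s (fun i => node R n (h i)) i (Ordinal n0) != 0.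
Proof.
move=> s0 hn i; rewrite mxE /= mul1r mulf_neq0 ?expf_neq0 ?gt_eqF //.
exact: sin_node_gt0.
Qed.

(** * Transfer from real to complex matrices, and the upper bound *)

Lemma map_subdiag_mx (R : realType) n :
  map_mx (real_complex R) (subdiag_mx R n) = shift_mx R[i] n.
Proof. by apply/matrixP=> i j; rewrite !mxE rmorph_nat. Qed.

Section RealComplex.
Local Open Scope sesquilinear_scope.

Lemma map_real_adjoint (R : realType) m n (A : 'M[R]_(m, n)) :
  (map_mx (real_complex R) A)^t* = map_mx (real_complex R) A^T.
Proof.
apply/matrixP=> i j; rewrite !mxE; exact: conjc_real.
Qed.

Lemma higher_rank_shift_le (R : realType) n k (r : R) :
  (1 <= k <= n)%N -> higher_rank_numerical_range k (shift_mx R[i] n) r%:C ->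
  r <= cos (node R n k).
Proof.
case/andP=> k1 kn [P [[PP Padj] rP PSP]].
have n0 : (0 < n)%N by apply: leq_trans kn.
(* As [k + m = n + 1], subspaces of ranks [k] and [m] in dimension [n] must meet. *)
set m := (n.+1 - k)%N.
pose h (i : 'I_m) := (k + i)%N.
have hn i : (0 < h i <= n)%N by rewrite /h; have := ltn_ord i; rewrite /m; lia.
pose V := sin_mx R m n (fun=> 1) (fun i => node R n (h i)).
pose H := subdiag_mx R n + (subdiag_mx R n)^T.
pose d : 'rV[R]_m := \row_i (2 * cos (node R n (h i))).
have VH : V *m H = diag_mx d *m V.
  have := @sin_mx_shift R m n (fun=> 1) (fun i => node R n (h i))
    (fun i => sin_mul_node R n (h i)).
  rewrite (_ : diag_mx _ = 1%:M) ?mul1mx -?mulmxDr; last first.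
    by apply/matrixP=> i j; rewrite !mxE expr1n.
  by move=> ->; congr (diag_mx _ *m _); apply/rowP=> i; rewrite !mxE mulr1.
have dinj : injective (d 0).
  have dlt (i j : 'I_m) : (i < j)%N -> d 0 j < d 0 i.
    move=> ij; rewrite !mxE ltr_pM2l // cos_node_lt ?ltn_add2l //.
    by have /andP[] := hn j.
  move=> i j dij; apply: val_inj; case: (ltngtP i j) => // /dlt.
    by rewrite dij ltxx.
  by rewrite dij ltxx.
have Vfree : row_free V.
  apply: (@pencil_row_free _ _ _ H 1%:M d V (Ordinal n0)); rewrite ?mulmx1 ?unitmx1 //.
  exact: sin_mx_free_col.
pose G := V *m V^T.
have GT : G^T = G by rewrite trmx_mul trmxK.
have HT : H^T = H by rewrite /H linearD /= trmxK addrC.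
have DG : diag_mx d *m G = V *m H *m V^T by rewrite VH mulmxA.
(* By symmetry of [H] the Gram matrix [G] commutes with [diag d]; as the [d_i] are distinct, [G] is
   diagonal, so the rows of [V] are orthogonal. *)
have comm : G *m diag_mx d = diag_mx d *m G.
  rewrite -[LHS]trmxK trmx_mul tr_diag_mx GT DG.
  by rewrite !trmx_mul trmxK HT mulmxA.
have Gd : G = diag_mx (\row_i G i i).
  apply/matrixP=> i j; have /matrixP/(_ i j) := comm.
  rewrite mul_mx_diag mul_diag_mx [X in X = _]mxE [X in _ = X]mxE => e.
  rewrite [RHS]mxE [X in X *+ _]mxE; case: (eqVneq i j) => [->|ij] //.
  move/eqP: e; rewrite mulr0n mulrC -subr_eq0 -mulrBl mulf_eq0 subr_eq0.
  by rewrite (inj_eq dinj) eq_sym (negPf ij) => /eqP.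
have G0 i : 0 <= G i i.
  by rewrite mxE sumr_ge0 // => j _; rewrite [V^T _ _]mxE -expr2 sqr_ge0.
pose Vc := map_mx (real_complex R) V.
have : (P :&: Vc)%MS != 0.
  have VcR : \rank Vc = m by rewrite mxrank_map; apply/eqP.
  have := mxrank_sum_cap P Vc; rewrite rP VcR -mxrank_eq0.
  have := rank_leq_col (P + Vc)%MS; rewrite /m; lia.
case/rowV0Pn=> x; rewrite sub_capmx => /andP[/submxP[y xP] /submxP[c xV]] x0.
have {y}xP : x = x *m P by rewrite xP -mulmxA PP.
have xPa : x^t* = P *m x^t* by rewrite {1}xP trmx_mul map_mxM Padj.
have xSx : x *m shift_mx R[i] n *m x^t* = r%:C *: (x *m x^t*).
  have -> : x *m shift_mx R[i] n *m x^t* = x *m P *m shift_mx R[i] n *m (P *m x^t*).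
    by rewrite -xP -xPa.
  rewrite !mulmxA -(mulmxA x P) -(mulmxA x (P *m _)) PSP.
  by rewrite -scalemxAr -scalemxAl -xP.
have xS'x : x *m (shift_mx R[i] n)^t* *m x^t* = r%:C *: (x *m x^t*).
  have := congr1 (fun M => M^t*) xSx.
  rewrite !trmx_mul !map_mxM trmxCK mulmxA => ->.
  rewrite linearZ /= map_mxZ trmx_mul map_mxM trmxCK; congr (_ *: _).
  exact: conjc_real.
have xHx : x *m map_mx (real_complex R) H *m x^t* = (2 * r)%:C *: (x *m x^t*).
  rewrite map_mxD map_subdiag_mx -map_real_adjoint map_subdiag_mx.
  rewrite mulmxDr mulmxDl xSx xS'x -scalerDl; congr (_ *: _).
  by rewrite -rmorphD mulr2n mulrDl mul1r.
have Gc : map_mx (real_complex R) (V *m V^T) = diag_mx (\row_i (G i i)%:C).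
  rewrite -/G [in LHS]Gd map_diag_mx; congr diag_mx; apply/rowP=> i.
  by rewrite !mxE.
have VHVc : map_mx (real_complex R) (V *m H *m V^T)
    = diag_mx (\row_i (d 0 i * G i i)%:C).
  rewrite -DG [in LHS]Gd mulmx_diag map_diag_mx; congr diag_mx; apply/rowP=> i.
  by rewrite 2!mxE [X in d 0 i * X]mxE [RHS]mxE.
have xaE : x^t* = map_mx (real_complex R) V^T *m c^t*.
  by rewrite xV trmx_mul map_mxM map_real_adjoint.
have xx : x *m x^t* = c *m diag_mx (\row_i (G i i)%:C) *m c^t*.
  by rewrite xaE xV -Gc map_mxM !mulmxA.
have xHx' : x *m map_mx (real_complex R) H *m x^t*
    = c *m diag_mx (\row_i (d 0 i * G i i)%:C) *m c^t*.
  by rewrite xaE xV -VHVc !map_mxM !mulmxA.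
have xx0 := row_sqnorm_gt0 _ _ _ x0.
(* In the coordinates [c] both forms are diagonal, and each eigenvalue [d_i] is at most [2 cos a_k]
   because [h i >= k]. *)
suff : (x *m map_mx (real_complex R) H *m x^t*) 0 0
    <= (2 * cos (node R n k))%:C * (x *m x^t*) 0 0.
  by rewrite xHx mxE ler_pM2r // lecR ler_pM2l.
rewrite xHx' xx !diag_form mulr_sumr; apply: ler_sum => i _.
rewrite 2!mxE [(\row__ _) 0 i]mxE [leRHS]mulrA -[_%:C * _%:C]rmorphM.
rewrite ler_wpM2r ?exprn_ge0 // lecR ler_wpM2r //.
rewrite ler_pM2l // /h; have [->|i0] := posnP i; first by rewrite addn0.
by have := hn i; rewrite /h => hi; apply/ltW/cos_node_lt; lia.
Qed.

(** * Lower bound at real points *)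

Lemma shift_isotropic_real (R : realType) n k (r : R) (Y : 'M[R]_(k, n)) :
  row_free Y -> Y *m (subdiag_mx R n - r%:M) *m Y^T = 0 ->
  higher_rank_numerical_range k (shift_mx R[i] n) r%:C.
Proof.
move=> Yfree Y0.
apply: (@isotropic_higher_rank _ _ _ _ _ (map_mx (real_complex R) Y)).
  by rewrite row_free_map.
by rewrite map_real_adjoint -map_subdiag_mx -map_scalar_mx -map_mxB -!map_mxM Y0 map_mx0.
Qed.

Lemma zero_higher_rank_shift (R : realType) n k :
  (k <= (n + 1) %/ 2)%N -> higher_rank_numerical_range k (shift_mx R[i] n) 0.
Proof.
(* Columns count from 0, so [i.*2] picks e_1, e_3, ...; no two positions differ by one, so the form
   of the shift vanishes on their span. *)
move=> kn; pose Y : 'M[R]_(k, n) := \matrix_(i, j) (j == i.*2 :> nat)%:R.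
have lt2 (i : 'I_k) : (i.*2 < n)%N by have := ltn_ord i; lia.
have YM p (M : 'M[R]_(n, p)) : Y *m M = \matrix_(i, j) M (Ordinal (lt2 i)) j.
  apply/matrixP=> i j; rewrite !mxE (bigD1 (Ordinal (lt2 i))) //= mxE eqxx mul1r.
  rewrite big1 ?addr0 // => m mi; rewrite mxE.
  by rewrite -(inj_eq val_inj) /= in mi; rewrite (negPf mi) mul0r.
rewrite -[0](rmorph0 (real_complex R)); apply: (@shift_isotropic_real _ _ _ _ Y).
  apply/row_freeP; exists Y^T; rewrite YM; apply/matrixP=> i j; rewrite !mxE /=.
  by rewrite (inj_eq double_inj).
rewrite raddf0 subr0 -mulmxA YM; apply/matrixP=> i j; rewrite !mxE big1 // => m _.
rewrite !mxE /=; case: eqP => [e|]; last by rewrite mul0r.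
by rewrite (_ : _ == _ = false) ?mulr0 //; lia.
Qed.

(* [s] is the smaller root of [r x^2 - 2 c x + r], rationalised. *)
Lemma reciprocal_root (R : rcfType) (r c : R) (s := r / (c + Num.sqrt (c ^+ 2 - r ^+ 2))) :
  0 < r <= c -> 0 < s <= 1 /\ 2 * s * c = r * (1 + s ^+ 2).
Proof.
case/andP=> r0 rc; have q0 := sqrtr_ge0 (c ^+ 2 - r ^+ 2).
have cr : 0 <= c ^+ 2 - r ^+ 2 by rewrite subr_ge0 ler_sqr ?nnegrE; lra.
have := sqr_sqrtr cr; rewrite /s; move: (Num.sqrt _) q0 => q q0 q2.
have cq : 0 < c + q by lra.
split; first by rewrite divr_gt0 // ler_pdivrMr //; lra.
have e : r ^+ 2 = c ^+ 2 - q ^+ 2 by rewrite q2; ring.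
have -> : r * (1 + (r / (c + q)) ^+ 2) = r * (1 + (r ^+ 2) / (c + q) ^+ 2).
  by field; rewrite gt_eqF.
by rewrite e; field; rewrite gt_eqF.
Qed.

Lemma higher_rank_shift_ge (R : realType) n k (r : R) :
  (1 <= k <= n)%N -> 0 < r <= cos (node R n k) ->
  higher_rank_numerical_range k (shift_mx R[i] n) r%:C.
Proof.
case/andP=> k1 kn /andP[r0 rk].
have n0 : (0 < n)%N by apply: leq_trans kn.
pose c (i : 'I_k) := cos (node R n i.+1).
pose s i := r / (c i + Num.sqrt (c i ^+ 2 - r ^+ 2)).
(* [i] counts from 0, so the angles are a_1, ..., a_k, and their cosines are all at least cos
   a_k. *)
have rc i : 0 < r <= c i.
  rewrite r0 (le_trans rk) //; have := ltn_ord i; rewrite leq_eqVlt => /orP[/eqP <-//|ik].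
  exact/ltW/cos_node_lt.
have s0 i : 0 < s i by have [/andP[]] := reciprocal_root _ _ _ (rc i).
have s1 i : s i <= 1 by have [/andP[]] := reciprocal_root _ _ _ (rc i).
have sE i : 2 * s i * c i = r * (1 + s i ^+ 2).
  by have [] := reciprocal_root _ _ _ (rc i).
(* [sE] recovers [c i] from [s i], and the cosine separates the nodes. *)
have sinj : injective s.
  have cinj (i j : 'I_k) : (i < j)%N -> c i = c j -> i = j.
    move=> ij cij; have := cos_node_lt R n i.+1 j.+1 ij; rewrite -/(c i) -/(c j) cij ltxx.
    by move=> H; have := ltn_ord j; move/leq_trans/(_ kn)/H.
  move=> i j sij; have cij : c i = c j.
    by have := sE i; rewrite sij -sE => /mulfI; apply; rewrite mulf_neq0 // gt_eqF.
  case: (ltngtP i j) => [ij|ji|/val_inj//]; first exact: cinj.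
  by apply/esym/cinj.
pose Y := sin_mx R k n s (fun i : 'I_k => node R n i.+1).
pose A := subdiag_mx R n - r%:M.
pose d : 'rV[R]_k := \row_i - s i ^+ 2.
(* Substitute [2 s c = r (1 + s^2)] in [sin_mx_shift] and regroup the terms in [r]. *)
have YA : Y *m A = diag_mx d *m Y *m A^T.
  have := sin_mx_shift R k n s (fun i : 'I_k => node R n i.+1)
    (fun i => sin_mul_node R n i.+1).
  rewrite -/Y => /matrixP e; apply/matrixP=> i j; have := e i j.
  rewrite /A mulmxBr mul_mx_scalar linearB /= tr_scalar_mx mulmxBr mul_mx_scalar.
  rewrite -[diag_mx d *m Y *m _]mulmxA -[_ *m Y *m (subdiag_mx R n)^T]mulmxA.
  rewrite mxE !mul_diag_mx !mxE -/(c i) sE; lra.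
have Au : A^T \in unitmx.
  rewrite unitmx_tr unitmxE unitfE det_trig; last first.
    apply/is_trig_mxP=> i j ij; rewrite !mxE -(inj_eq val_inj) (ltn_eqF ij).
    by rewrite (_ : _ == _ = false) ?subr0 //; lia.
  apply/prodf_neq0=> i _; rewrite !mxE eqxx (ltn_eqF (ltnSn i)) sub0r oppr_eq0.
  by rewrite gt_eqF.
apply: (@shift_isotropic_real _ _ _ _ Y).
  apply: (@pencil_row_free _ _ _ A A^T d Y (Ordinal n0)) => //.
    move=> i j; rewrite !mxE => /oppr_inj /eqP.
    by rewrite eqrXn2 ?ltW // => /eqP/sinj.
  by apply: sin_mx_free_col => // i; rewrite (leq_trans (ltn_ord i) kn).
rewrite -/A; set G := Y *m A *m Y^T.
(* The pencil relation [YA] reads [G = diag d G^T], since [G^T] is [Y A^T Y^T]. *)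
have GE i j : G i j = - s i ^+ 2 * G j i.
  have : G = diag_mx d *m G^T by rewrite /G !trmx_mul trmxK YA !mulmxA.
  by move/matrixP/(_ i j); rewrite mul_diag_mx => ->; rewrite [LHS]mxE [d _ _]mxE [_^T _ _]mxE.
apply/matrixP=> i j; rewrite [RHS]mxE.
have [<-|ij] := eqVneq i j.
  have : (1 + s i ^+ 2) * G i i = 0 by rewrite mulrDl mul1r {1}GE mulNr addNr.
  have /gt_eqF p : 0 < 1 + s i ^+ 2 by rewrite ltr_wpDr ?sqr_ge0.
  by move/eqP; rewrite mulf_eq0 p /= => /eqP.
have : (1 - (s i * s j) ^+ 2) * G i j = 0.
  by rewrite mulrBl mul1r {1}GE GE; ring.
move/eqP; rewrite mulf_eq0 subr_eq0 eq_sym => /orP[|/eqP//].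
(* Both weights are at most 1 and they differ, so their product is below 1. *)
have -> // : ((s i * s j) ^+ 2 == 1) = false.
have sij : s i != s j by rewrite (inj_eq sinj).
rewrite lt_eqF // expr_lt1 //; last exact: mulr_ge0 (ltW (s0 i)) (ltW (s0 j)).
have [si1|] := ltP (s i) 1; first by rewrite (le_lt_trans _ si1) // ler_piMr // ltW.
move=> si1; have si : s i = 1 by apply/le_anti; rewrite s1.
by rewrite si mul1r lt_neqAle s1 andbT eq_sym -si.
Qed.

End RealComplex.

(** * All complex points by rotation, and the empty case *)

Theorem theorem2p1 (R : realType) (n k : nat)
    (hn : (2 <= n)%N) (hk1 : (1 <= k)%N) (hkn : (k <= n)%N) :
  ((k <= (n + 1) %/ 2)%N ->
     higher_rank_numerical_range k (shift_mx R[i] n) =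
     [set z : R[i] | `|z| <= (cos (k%:R * pi / (n + 1)%:R : R))%:C]) /\
  (((n + 1) %/ 2 < k)%N ->
     higher_rank_numerical_range k (shift_mx R[i] n) = set0).
Proof.
have k1n : (1 <= k <= n)%N by rewrite hk1.
have normE (z : R[i]) : `|z| = (complex.Re `|z|)%:C by rewrite RRe_real ?normr_real.
have in_norm (z : R[i]) : higher_rank_numerical_range k (shift_mx R[i] n) z ->
    `|z| <= (cos (node R n k))%:C.
  move=> zL; rewrite normE lecR; apply: higher_rank_shift_le => //; rewrite -normE.
  case: (eqVneq z 0) zL => [->|z0] zL; first by rewrite normr0.
  have -> : `|z| = (`|z| / z) * z by rewrite divfK.
  apply: higher_rank_shift_rotate zL.
  by rewrite normf_div normr_id divff ?normr_eq0.
split=> hk.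
  apply/seteqP; split=> z //= zc; first exact: in_norm.
  have [->|z0] := eqVneq z 0; first exact: zero_higher_rank_shift.
  have -> : z = (z / `|z|) * `|z| by rewrite divfK ?normr_eq0.
  apply: higher_rank_shift_rotate; first by rewrite normf_div normr_id divff ?normr_eq0.
  rewrite normE; apply: higher_rank_shift_ge => //.
  by rewrite -lecR -ltcR -normE normr_gt0 z0.
apply/seteqP; split=> z // /in_norm zc.
have : 0 <= (cos (node R n k))%:C by apply: le_trans zc.
rewrite lecR leNgt => /negP; apply.
(* [n + 1 < 2 k] puts a_k beyond pi/2, where the cosine is negative, against
   [0 <= |z| <= cos a_k]. *)
rewrite -(cos_pihalf R) ltr_cos ?node_itv //; last first.
  by rewrite in_itv /= divr_ge0 ?pi_ge0 //= ler_pdivrMr // ler_peMr ?pi_ge0 // ler1n.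
rewrite /node [_ * pi]mulrC -mulrA ltr_pM2l ?pi_gt0 //.
rewrite ltr_pdivlMr ?ltr0n ?addn1 // mulrC ltr_pdivrMr // -natrM ltr_nat.
lia.
Qed.
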